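(* Let $X$ be a (real) Hausdorff locally convex space and let $C,D\subset X$ be nonempty convex sets. (i) If $C\cap\operatorname{qri}D\neq\emptyset$, then $\operatorname{qri}(C\cap D)\subset C\cap\operatorname{qri}D$. (ii) If $\operatorname{qri}C\cap\operatorname{qri}D\neq\emptyset$, then $\operatorname{qri}(C\cap D)\subset\operatorname{qri}C\cap\operatorname{qri}D$.
   Context: For a set $A\subset X$, $\operatorname{cone}A$ denotes the conic hull of $A$, containing $0$ by convention; for convex $A\neq\emptyset$ it is $\{ta \mid t\ge 0,\ a\in A\}$. Its closure is denoted $\overline{\operatorname{cone}}A$. For a convex set $C\subset X$, the quasi relative interior of $C$ is $$\operatorname{qri}C:=\{x\in C\mid \overline{\operatorname{cone}}(C-x)\text{ is a linear subspace of }X\}.$$ The inclusion sign $\subset$ allows equality. *)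

(* Defs.v *)
From mathcomp Require Import all_boot all_order all_algebra.
From mathcomp Require Import all_classical all_reals all_analysis.

Set Implicit Arguments.
Unset Strict Implicit.
Unset Printing Implicit Defensive.

Import Order.TTheory GRing.Theory Num.Theory.
Import numFieldNormedType.Exports.

Local Open Scope classical_set_scope.
Local Open Scope ring_scope.

Definition convex_cone (R : realType) (V : lmodType R) (K : set V) : Prop :=
  [/\ K 0, (forall (t : R) (a : V), 0 <= t -> K a -> K (t *: a))
    & convex_set (K : set (convex_lmodType V))].

(* The least convex cone containing [A] and the origin, so [cone set0 = [set 0]];
   for convex nonempty [A] it is the set of all [t *: a], see [cone_convexE]. *)
Definition cone (R : realType) (V : lmodType R) (A : set V) : set V :=
  smallest (@convex_cone R V) A.

Lemma cone_convexE (R : realType) (V : lmodType R) (A : set V) :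
  convex_set (A : set (convex_lmodType V)) -> A !=set0 ->
  cone A = [set v | exists t : R, 0 <= t /\ exists2 a, A a & v = t *: a].
Proof.
move=> cA [a0 Aa0]; apply/seteqP; split; last first.
  move=> _ [t [t0 [a Aa ->]]] K [[_ Kt _] AK].
  by apply: Kt => //; exact: AK.
apply: smallest_sub; last first.
  by move=> a Aa; exists 1; split=> //; exists a; rewrite ?scale1r.
split; first by exists 0; split=> //; exists a0; rewrite ?scale0r.
  move=> t _ t0 [s [s0 [a Aa ->]]]; exists (t * s).
  by split; [exact: mulr_ge0|exists a => //; rewrite scalerA].
move=> x y l; rewrite !inE => -[s [s0 [a Aa ->]]] [t [t0 [b Ab ->]]].
set p : R := l%:num * s; set q : R := (1 - l%:num) * t.
have p0 : 0 <= p by apply: mulr_ge0.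
have q0 : 0 <= q by apply: mulr_ge0.
have convE : conv l (s *: a : convex_lmodType V) (t *: b) = p *: a + q *: b.
  by rewrite /conv /= /p /q !scalerA.
rewrite convE; exists (p + q); split; first exact: addr_ge0.
have [pq0|pqN0] := eqVneq (p + q) 0.
  exists a0 => //; rewrite pq0 scale0r.
  have /eqP := pq0; rewrite paddr_eq0// => /andP[/eqP -> /eqP ->].
  by rewrite !scale0r addr0.
have pq_gt0 : 0 < p + q by rewrite lt_neqAle eq_sym pqN0 addr_ge0.
have r0 : 0 <= p / (p + q) by rewrite divr_ge0// addr_ge0.
have r1 : p / (p + q) <= 1 by rewrite ler_pdivrMr// mul1r lerDl.
pose m : {i01 R} := Itv01 r0 r1.
exists (conv m (a : convex_lmodType V) b).
  by apply/set_mem/cA; rewrite inE.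
rewrite [conv _ _ _](_ : _ = (p / (p + q)) *: a + (1 - p / (p + q)) *: b)//.
rewrite scalerDr !scalerA mulrBr mulr1 [(p + q) * _]mulrC divfK//.
by rewrite [p + q]addrC addrK.
Qed.

Definition linear_subspace (R : realType) (V : lmodType R) (S : set V) : Prop :=
  submod_closed (mem S).

(* Meaningful for convex [C]; convexity is left to the statements. *)
Definition qri (R : realType) (X : tvsType R) (C : set X) : set X :=
  [set x | C x /\ linear_subspace (closure (cone [set y - x | y in C]))].

(* Main.v *)
(** If [x] is in [qri (C `&` D)] and [x0] in [C `&` qri D], then [x0 - x], hence
    also [x - x0], is in the closed convex cone [L] generated by [D - x].  So
    [D - x0], and the closed cone it generates, lie in [L]; as the latter is a
    subspace, [L] contains [x0 - y], and thus [x - y], for every [y] in [D]. *)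
Require Import Defs.
From mathcomp Require Import all_boot all_order all_algebra.
From mathcomp Require Import all_classical all_reals all_analysis.

Import Order.TTheory GRing.Theory Num.Theory.
Import numFieldNormedType.Exports.

Local Open Scope classical_set_scope.
Local Open Scope ring_scope.

(** A sum is twice a midpoint, and a convex combination is a sum of two nonnegative multiples.
    Stability under addition is the form in which cones are handled below. *)
Lemma convex_coneP (R : realType) (V : lmodType R) (K : set V) :
  convex_cone K <->
  [/\ K 0, (forall (t : R) a, 0 <= t -> K a -> K (t *: a))
    & forall a b, K a -> K b -> K (a + b)].
Proof.
split=> -[K0 KZ K2]; split=> //.
- move=> a b Ka Kb.
  have h0 : 0 <= 2^-1 :> R by rewrite invr_ge0.
  have h1 : 2^-1 <= 1 :> R by rewrite invf_le1// ler1n.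
  have Km : K (conv (Itv01 h0 h1) (a : convex_lmodType V) b).
    by apply/set_mem/K2; rewrite inE.
  have -> : a + b = 2 *: conv (Itv01 h0 h1) (a : convex_lmodType V) b.
    rewrite [conv _ _ _](_ : _ = 2^-1 *: a + (1 - 2^-1) *: b)//.
    rewrite scalerDr !scalerA mulrBr mulr1 mulfV ?pnatr_eq0//.
    by rewrite -[2]/(1 + 1 : R) addrK !scale1r.
  exact: KZ.
- move=> a b l; rewrite !inE => Ka Kb.
  rewrite [conv _ _ _](_ : _ = l%:num *: (a : V) + (1 - l%:num) *: (b : V))//.
  by apply: K2; apply: KZ => //; rewrite subr_ge0.
Qed.

Lemma convex_cone_cone (R : realType) (V : lmodType R) (A : set V) :
  convex_cone (cone A).
Proof.
apply/convex_coneP; split.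
- by move=> K [/convex_coneP[]].
- move=> t a t0 Aa K KA; have [/convex_coneP[_ KZ _] _] := KA.
  by apply: KZ => //; exact: Aa.
- move=> a b Aa Ab K KA; have [/convex_coneP[_ _ KD] _] := KA.
  by apply: KD; [exact: Aa|exact: Ab].
Qed.

(** Lets a cone be compared with its own reflection by minimality of the conic hull. *)
Lemma convex_cone_opp (R : realType) (V : lmodType R) (K : set V) :
  convex_cone K -> convex_cone (-%R @^-1` K).
Proof.
move=> /convex_coneP[K0 KZ KD]; apply/convex_coneP; split=> /=.
- by rewrite oppr0.
- by move=> t a t0 Ka; rewrite -scalerN; exact: KZ.
- by move=> a b Ka Kb; rewrite opprD; exact: KD.
Qed.

(** Joint continuity of scaling and of addition carries approximating points of [K] to approximating
    points of the result. *)
Lemma convex_cone_closure (R : realType) (X : tvsType R) (K : set X) :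
  convex_cone K -> convex_cone (closure K).
Proof.
move=> /convex_coneP[K0 KZ KD]; apply/convex_coneP; split.
- exact: subset_closure.
- move=> t a t0 Ka B Bta.
  have [[P Q] [/= Pt Qa] PQB] := @scale_continuous R X (t, a) _ Bta.
  have [b [Kb Qb]] := Ka _ Qa; exists (t *: b); split; first exact: KZ.
  (* Only the vector is approximated; the scalar stays equal to [t], so it remains nonnegative. *)
  by apply: (PQB (t, b)); split=> //; exact: nbhs_singleton Pt.
- move=> a b Ka Kb B Bab.
  have [[P Q] [/= Pa Qb] PQB] := @add_continuous X (a, b) _ Bab.
  have [a' [Ka' Pa']] := Ka _ Pa; have [b' [Kb' Qb']] := Kb _ Qb.
  by exists (a' + b'); split; [exact: KD|exact: (PQB (a', b'))].
Qed.

Lemma closure_cone_sub (R : realType) (X : tvsType R) (A K : set X) :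
  convex_cone K -> closed K -> A `<=` K -> closure (cone A) `<=` K.
Proof.
move=> coneK closedK AK; rewrite closureE; apply: smallest_sub => //.
exact: smallest_sub.
Qed.

Lemma sub_closure_cone (R : realType) (X : tvsType R) (A : set X) :
  A `<=` closure (cone A).
Proof. by apply: subset_trans (@subset_closure _ _); exact: sub_smallest. Qed.

Lemma linear_subspaceN (R : realType) (V : lmodType R) (S : set V) (a : V) :
  linear_subspace S -> S a -> S (- a).
Proof.
move=> [S0 /(_ (-1) a 0) + Sa].
by rewrite addr0 scaleN1r => SN; apply/set_mem/SN => //; exact: mem_set.
Qed.

(** Negation need only be checked on generators: the reflection of the closed cone is again a closed
    convex cone, so once it contains [A] it contains the whole closed cone. A convex cone stable
    under negation is a subspace. *)
Lemma linear_subspace_closure_cone (R : realType) (X : tvsType R) (A : set X) :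
  (forall a, A a -> closure (cone A) (- a)) ->
  linear_subspace (closure (cone A)).
Proof.
move=> AN; set K := closure (cone A).
have coneK : convex_cone K by exact/convex_cone_closure/convex_cone_cone.
have KN : K `<=` -%R @^-1` K.
  apply: closure_cone_sub => //; first exact: convex_cone_opp.
  apply: closed_comp; last exact: closed_closure.
  by move=> a _; exact: opp_continuous.
have /convex_coneP[K0 KZ KD] := coneK.
split; first exact: mem_set.
move=> t a b /set_mem Ka /set_mem Kb; apply/mem_set/KD => //.
have [t0|/ltW t0] := leP 0 t; first exact: KZ.
by rewrite -[t *: a]opprK -scaleNr; apply: KN; apply: KZ; rewrite ?oppr_ge0.
Qed.

Lemma qri_setI_subr (R : realType) (X : tvsType R) (C D : set X) :
  C `&` qri D !=set0 -> qri (C `&` D) `<=` C `&` qri D.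
Proof.
move=> [x0 [Cx0 [Dx0 linD]]] x [[Cx Dx] linCD]; split=> //; split=> //.
set L := closure (cone [set y - x | y in D]).
have coneL : convex_cone L by exact/convex_cone_closure/convex_cone_cone.
have closedL : closed L by exact: closed_closure.
have /convex_coneP[_ _ LD] := coneL.
have DL y : D y -> L (y - x) by move=> Dy; apply: sub_closure_cone; exists y.
have Lxx0 : L (x - x0).
  have CDL : closure (cone [set y - x | y in C `&` D]) `<=` L.
    by apply: closure_cone_sub => // _ [y [_ Dy] <-]; exact: DL.
  rewrite -opprB; apply: CDL; apply: (linear_subspaceN _ _ _ _ linCD).
  by apply: sub_closure_cone; exists x0.
have Dx0L : closure (cone [set y - x0 | y in D]) `<=` L.
  apply: closure_cone_sub => // _ [y Dy <-].
  (* Here [y - x0 = (y - x) + (x - x0)]. *)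
  by rewrite -(subrKA x); apply: LD => //; exact: DL.
apply: linear_subspace_closure_cone => _ [y Dy <-].
(* Here [x - y = (x - x0) + (x0 - y)], where [x0 - y] is the negative of a generator of the subspace
   based at [x0]. *)
rewrite opprB -(subrKA x0); apply: LD => //.
rewrite -opprB; apply: Dx0L; apply: (linear_subspaceN _ _ _ _ linD).
by apply: sub_closure_cone; exists y.
Qed.

Theorem proposition3 (R : realType) (X : tvsType R) (hX : hausdorff_space X)
    (C D : set X) (C0 : C !=set0) (D0 : D !=set0)
    (cC : convex_set (C : set (convex_lmodType X)))
    (cD : convex_set (D : set (convex_lmodType X))) :
  (C `&` qri D !=set0 -> qri (C `&` D) `<=` C `&` qri D) /\
  (qri C `&` qri D !=set0 -> qri (C `&` D) `<=` qri C `&` qri D).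
Proof.
split; first exact: qri_setI_subr.
(* The second claim is the first one used twice, once with [C] and [D] exchanged. *)
move=> [x0 [qCx0 qDx0]] x qCDx; split.
- have /qri_setI_subr : D `&` qri C !=set0 by exists x0; split=> //; case: qDx0.
  by move=> /(_ x)[]; rewrite // setIC.
- have /qri_setI_subr : C `&` qri D !=set0 by exists x0; split=> //; case: qCx0.
  by move=> /(_ x)[].
Qed.
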